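(* Let $G$ be a connected chordal graph. Then $\operatorname{eMLD}(G)=1$.
   Context: All graphs are finite, simple and undirected. For a $d\times d$ symmetric matrix $\Gamma$ (real or complex) with zero diagonal put $$\operatorname{CM}(\Gamma)=\begin{pmatrix}-\tfrac12\Gamma&\mathbf{1}\\ \mathbf{1}^\top&0\end{pmatrix},$$ and, when this is invertible, let $\theta(\Gamma)$ be the upper-left $d\times d$ block of $\operatorname{CM}(\Gamma)^{-1}$. A partially-specified conditionally negative definite variogram with respect to $G=(V,E)$ is a symmetric partial matrix $\mathring\Gamma$ with zero diagonal and real entries $\mathring\Gamma_{ij}$ specified exactly for $(i,j)\in E$, all of whose principal submatrices indexed by cliques of $G$ are conditionally negative definite (i.e. $v^\top M v<0$ for all real $v\neq\mathbf{0}$ with $v\perp\mathbf{1}$). The matrix completion problem for $G$ and $\mathring\Gamma$ asks for a symmetric matrix $\Gamma$ with zero diagonal and $\Theta=\theta(\Gamma)$ satisfying $$\Gamma_{ij}=\mathring\Gamma_{ij}\ \ \forall (i,j)\in E,\qquad \Theta_{ij}=0\ \ \forall (i,j)\notin E,\ i\neq j .$$ The extremal (surrogate) maximum likelihood degree $\operatorname{eMLD}(G)$ is the number of complex solutions $\Gamma$ of these equations (dropping the requirement of conditional negative definiteness) for generic $\mathring\Gamma$, i.e. for $\mathring\Gamma$ outside a proper algebraic subset of the space of edge values. *)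

(* Defs.v *)
From mathcomp Require Import all_boot all_order all_algebra.
From mathcomp Require Import reals complex mpoly.

Set Implicit Arguments.
Unset Strict Implicit.
Unset Printing Implicit Defensive.

Import GRing.Theory Num.Theory.

Local Open Scope ring_scope.

Record sgraph (d : nat) := SGraph {
  adj :> rel 'I_d;
  adj_sym : ssrbool.symmetric adj;
  adj_irr : irreflexive adj
}.

Section Graphs.
Variables (d : nat) (G : sgraph d).

(* The graph without vertices is not connected. *)
Definition connected_graph : Prop :=
  (0 < d)%N /\ forall x y : 'I_d, connect G x y.

(* Every cycle of length at least 4 has a chord: an edge joining two vertices
   of the cycle which are not consecutive on it. *)
Definition chordal : Prop :=
  forall c : seq 'I_d, ucycle G c -> (3 < size c)%N ->
    exists x y : 'I_d,
      [/\ x \in c, y \in c, G x y, y != next c x & x != next c y].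

(* Each undirected edge is represented once, by its increasing pair. *)
Definition edge := {p : 'I_d * 'I_d | (p.1 < p.2)%N && G p.1 p.2}.

End Graphs.

Section CayleyMenger.
Variables (F : fieldType) (d : nat).

Definition CM (Gamma : 'M[F]_d) : 'M[F]_(d + 1) :=
  block_mx (- (2%:R^-1 *: Gamma)) (const_mx 1) (const_mx 1) 0.

(* Meaningful when CM Gamma \in unitmx. *)
Definition theta (Gamma : 'M[F]_d) : 'M[F]_d := ulsubmx (invmx (CM Gamma)).

End CayleyMenger.

Section MLDegree.
Variables (R : realType) (d : nat) (G : sgraph d).

Definition edge_eval (p : {mpoly R[#|{: edge G}|]}) (g : edge G -> R) : R :=
  p.@[fun k => g (enum_val k)].

Definition algebraic_subset (Z : (edge G -> R) -> Prop) : Prop :=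
  exists S : {mpoly R[#|{: edge G}|]} -> Prop,
    forall g, Z g <-> forall p, S p -> edge_eval p g = 0.

Definition generically (P : (edge G -> R) -> Prop) : Prop :=
  exists Z : (edge G -> R) -> Prop,
    [/\ algebraic_subset Z, exists g, ~ Z g & forall g, ~ Z g -> P g].

(* Positive definiteness conditions play no role here: neither the solution
   Gamma nor the edge values g are required to be conditionally negative
   definite. *)
Definition completion (g : edge G -> R) (Gamma : 'M[R[i]]_d) : Prop :=
  [/\ Gamma^T = Gamma,
      forall i, Gamma i i = 0,
      CM Gamma \in unitmx,
      forall e : edge G, Gamma (val e).1 (val e).2 = (g e)%:C%C
    & forall i j, i != j -> ~~ G i j -> theta Gamma i j = 0].

Definition num_completions (g : edge G -> R) (k : nat) : Prop :=
  exists s : seq 'M[R[i]]_d,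
    [/\ uniq s, size s = k & forall Gamma, Gamma \in s <-> completion g Gamma].

(* eMLD k means eMLD(G) = k; see eMLD_unique. *)
Definition eMLD (k : nat) : Prop :=
  generically (fun g => num_completions g k).

Lemma num_completions_unique g k l :
  num_completions g k -> num_completions g l -> k = l.
Proof.
move=> [s [us <- Hs]] [t [ut <- Ht]]; apply/perm_size/uniq_perm => // x.
by apply/idP/idP => [/Hs/Ht|/Ht/Hs].
Qed.

Lemma edge_eval_line (p : {mpoly R[#|{: edge G}|]}) (g h : edge G -> R) :
  exists q : {poly R}, forall t, q.[t] = edge_eval p (fun e => g e + t * h e).
Proof.
exists (mmap polyC (fun k => (g (enum_val k))%:P + h (enum_val k) *: 'X) p).
move=> t; rewrite /edge_eval mevalE /mmap horner_sum; apply: eq_bigr => m _.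
rewrite hornerM hornerC /mmap1 horner_prod; congr (_ * _).
by apply: eq_bigr => k _; rewrite horner_exp !hornerE mulrC.
Qed.

Lemma algebraic_subset_out (Z : (edge G -> R) -> Prop) g :
  algebraic_subset Z -> ~ Z g ->
  exists p, edge_eval p g != 0 /\ forall h, edge_eval p h != 0 -> ~ Z h.
Proof.
move=> [S HS] ng; have [//|np] := boolp.pselect (exists p,
  edge_eval p g != 0 /\ forall h, edge_eval p h != 0 -> ~ Z h).
case: ng; apply/HS => p Sp; apply/eqP/negPn/negP => pg.
by apply: np; exists p; split=> // h /eqP ph /HS /(_ p Sp).
Qed.

Lemma generically_and (P Q : (edge G -> R) -> Prop) :
  generically P -> generically Q -> exists g, P g /\ Q g.
Proof.
move=> [Y [Yalg [g Yg] YP]] [Z [Zalg [h Zh] ZQ]].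
have [p [pg pY]] := algebraic_subset_out Yalg Yg.
have [q [qh qZ]] := algebraic_subset_out Zalg Zh.
pose v e := h e - g e.
have [p' p'E] := edge_eval_line p g v.
have [q' q'E] := edge_eval_line q g v.
have eval_ext r (a b : edge G -> R) : a =1 b -> edge_eval r a = edge_eval r b.
  by move=> ab; apply: meval_eq => k; apply: ab.
have p'0 : p' != 0.
  apply: contraNneq pg => p'0; rewrite -(eval_ext p (fun e => g e + 0 * v e)).
    by rewrite -p'E p'0 horner0.
  by move=> e /=; rewrite mul0r addr0.
have q'0 : q' != 0.
  apply: contraNneq qh => q'0; rewrite -(eval_ext q (fun e => g e + 1 * v e)).
    by rewrite -q'E q'0 horner0.
  by move=> e /=; rewrite mul1r addrC subrK.
have pq0 : p' * q' != 0 by rewrite mulf_neq0.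
pose rs := [seq k%:R : R | k <- iota 0 (size (p' * q'))].
have [rs0|/allPn[t _]] := boolP (all (root (p' * q')) rs).
  have /(max_poly_roots pq0 rs0) : uniq rs.
    by rewrite map_inj_uniq ?iota_uniq//; apply: mulrIn; rewrite oner_eq0.
  by rewrite size_map size_iota ltnn.
rewrite rootE hornerM mulf_eq0 negb_or => /andP[pt qt].
exists (fun e => g e + t * v e); split.
  by apply/YP/pY; rewrite -p'E.
by apply/ZQ/qZ; rewrite -q'E.
Qed.

Lemma eMLD_unique k l : eMLD k -> eMLD l -> k = l.
Proof.
move=> Hk Hl; have [g [gk gl]] := generically_and Hk Hl.
exact: num_completions_unique gk gl.
Qed.

End MLDegree.

(* Main.v *)
Require Import Defs.
From mathcomp Require Import all_boot all_order all_algebra.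
From mathcomp Require Import reals complex mpoly.
From mathcomp Require Import zify.

(** Why the theorem holds.

    The matrix CM(Gamma) has one more row and column than Gamma, and its border
    is constant.  Add to G an apex adjacent to every vertex.  Fixing the values
    of Gamma on the edges of G amounts to fixing the entries of CM(Gamma) on the
    diagonal and on the edges of this cone, and the equations theta(Gamma)_ij = 0
    say that the inverse of CM(Gamma) vanishes on the non-edges of the cone.  So
    the question is the classical completion problem for symmetric matrices, as
    for Gaussian graphical models, but without positivity and over the complex
    numbers.

    For a chordal graph that problem is solved by adding vertices one at a time.
    Let A be a set of vertices, v a new vertex and C the set of its neighbours
    in A, a clique.  If M is a completion on v + A, then row v of the inverse of
    M is supported on v + C, because the inverse vanishes on the non-edges.  It
    is therefore the row x with x M_{v + C} = e_v, and so depends on the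
    prescribed entries only; moreover x_v != 0 when M_C is invertible.  The
    remaining equations of x M = e_v read, for b in A \ C,
    x_v M_vb + sum_(i in C) x_i M_ib = 0, so they determine the missing
    entries M_vb from M on A.  The inverses of M and of its restriction to A
    differ on A by x^T x / x_v (a Schur complement), a matrix that vanishes on
    the non-edges because C is a clique; hence M is a completion on v + A if and
    only if its restriction is one on A ([markov_elim]).  Existence and
    uniqueness follow by induction ([completes_exists], [completes_unique]).

    The order in which the vertices are added comes from Dirac's theorem: a
    chordal graph has a simplicial vertex ([simplicial_exists]), and removing it
    preserves connectedness ([cut_connected_rem]).  Connectedness ensures that C
    always contains a vertex of G besides the apex; this matters since the
    principal submatrix on the apex alone is the zero matrix.

    The construction works as soon as the Cayley-Menger determinants of all
    nonempty cliques are nonzero.  Their product is a polynomial in the edge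
    values, and it is not the zero polynomial because it does not vanish when
    all edge values are 1 ([simplex_unit]: the vertices of a regular simplex). *)

Set Implicit Arguments.
Unset Strict Implicit.
Unset Printing Implicit Defensive.

Import GRing.Theory Num.Theory.

(** * Chordal graphs *)

Definition clique (T : finType) (e : rel T) (Q : {set T}) :=
  [forall x in Q, forall y in Q, e x y].

Lemma cliqueP (T : finType) (e : rel T) (Q : {set T}) :
  reflect {in Q &, forall x y, e x y} (clique e Q).
Proof.
apply: (iffP 'forall_in_'forall_in_idP) => [h x y xQ yQ|h x xQ y yQ].
  exact: h.
exact: h.
Qed.

Lemma cliqueS (T : finType) (e : rel T) (Q Q' : {set T}) :
  Q \subset Q' -> clique e Q' -> clique e Q.
Proof. by move=> /subsetP s /cliqueP h; apply/cliqueP => x y /s ? /s ?; apply: h. Qed.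

Section Chordal.
Variables (d : nat) (G : sgraph d).

(** Reflexive, so that cliques and closed neighbourhoods need no side condition. *)
Definition adjeq (x y : 'I_d) := (x == y) || G x y.

Lemma adjeq_sym : ssrbool.symmetric adjeq.
Proof. by move=> x y; rewrite /adjeq eq_sym (adj_sym G). Qed.

Lemma adjeq_refl : reflexive adjeq.
Proof. by move=> x; rewrite /adjeq eqxx. Qed.

Lemma shortcut_lt i j n : i.+1 < j -> j <= n -> i + (n - j.-1) < n.
Proof. by lia. Qed.

(** The heart of Dirac's argument: two neighbours x and y of u that are joined
    by a path with interior in B, where B avoids the closed neighbourhood of u,
    are equal or adjacent.  Otherwise u together with a shortest such path is a
    cycle of length at least 4 without a chord. *)
Lemma separator_adj (B : {set 'I_d}) (u x y : 'I_d) (r0 : seq 'I_d) :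
  chordal G ->
  {in B, forall b, ~~ adjeq u b} -> G u x -> G u y -> x \notin B -> y \notin B ->
  path G x r0 -> last x r0 = y -> {subset r0 <= y |: B} ->
  adjeq x y.
Proof.
move=> chG uB ux uy xB yB r0p r0l r0B; apply/negPn/negP; rewrite /adjeq negb_or.
move=> /andP[xy nGxy].
(* Take r of minimal length, and without repetition thanks to shortenP. *)
pose good k := [exists t : k.-tuple 'I_d,
  [&& path G x t, last x t == y & all (mem (y |: B)) t]].
have goodE r : path G x r -> last x r = y -> {subset r <= y |: B} ->
    good (size r).
  move=> p l s; apply/existsP; exists (in_tuple r); rewrite /= p l eqxx /=.
  by apply/allP => z /s.
have exg : exists k, good k by exists (size r0); apply: goodE.
have [k /existsP[t /and3P[tp /eqP tl /allP tB]] kmin] := ex_minnP exg.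
have szt := size_tuple t.
move: tl tB szt; case/shortenP: tp => r rp ru rt rl tB szt.
have rB : {subset r <= y |: B} by move=> z /rt /tB.
have rk : size r <= k.
  by rewrite -szt; apply: uniq_leq_size => //; case/andP: ru.
have rmin s : path G x s -> last x s = y -> {subset s <= y |: B} ->
    size r <= size s.
  by move=> ? ? ?; apply: leq_trans rk _; apply/kmin/goodE.
have uxN : u != x by apply: contraTneq ux => ->; rewrite (adj_irr G).
have uyN : u != y by apply: contraTneq uy => ->; rewrite (adj_irr G).
have uNB : u \notin B by apply/negP => /uB; rewrite adjeq_refl.
have ur : u \notin x :: r.
  rewrite inE negb_or uxN /=; apply/negP => /rB; rewrite !inE.
  by rewrite (negbTE uyN) (negbTE uNB).
have cyc : ucycle G (u :: x :: r).
  apply/andP; split; last by rewrite cons_uniq ur.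
  by rewrite /= rcons_path ux rp rl (adj_sym G) uy.
have sz : 3 < size (u :: x :: r).
  case: (r) rl rp => [|a [|b s]] //= h; first by rewrite h eqxx in xy.
  by rewrite h (negbTE nGxy).
have uonly z : z \in x :: r -> G u z -> z = x \/ z = y.
  rewrite inE => /orP[/eqP-> _|/rB]; first by left.
  rewrite !inE => /orP[/eqP-> _|/uB]; first by right.
  by rewrite /adjeq negb_or => /andP[_ /negbTE->].
have nextE a : a \in x :: r ->
    next (u :: x :: r) a = nth u (x :: r) (index a (x :: r)).+1.
  move=> ar; rewrite next_nth inE ar orbT.
  rewrite -[index a (u :: _)]/(if u == a then _ else _).
  by case: eqP ar => // <-; rewrite (negbTE ur).
have nextu : next (u :: x :: r) u = x by rewrite /= eqxx.
have nexty : next (u :: x :: r) y = u.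
  rewrite nextE -?rl ?mem_last // index_last // nth_default //.
(* Elements of x :: r that are adjacent in G are consecutive, as otherwise the
   path could be shortened by going from the first to the second directly. *)
have noshort a b : a \in x :: r -> b \in x :: r -> G a b ->
   index a (x :: r) < index b (x :: r) -> b = next (u :: x :: r) a.
  move=> ar br ab ij; rewrite nextE //.
  have [<-|] := eqVneq (index b (x :: r)) (index a (x :: r)).+1.
    by rewrite nth_index.
  move: ij; set i := index a _; set j := index b _ => ij jNi.
  have {}ij : i.+1 < j by rewrite ltn_neqAle eq_sym jNi.
  have jr : j <= size r by have := br; rewrite -index_mem ltnS.
  have j1 : j.-1.+1 = j by case: (j) ij.
  have Ei : last x (take i r) = a.
    rewrite -(nth_index x ar) -/i.
    have := @nth_last _ x (x :: take i r); rewrite /= size_take.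
    rewrite (leq_trans (ltnW ij) jr).
    by move=> <-; case: (i) ij => //= i' _; rewrite nth_take.
  have Ej : drop j.-1 r = b :: drop j r.
    rewrite (drop_nth x) ?j1 //.
    congr cons; rewrite -[RHS](nth_index x br) -/j.
    by case: (j) ij.
  have := rmin (take i r ++ drop j.-1 r); rewrite size_cat size_drop.
  rewrite size_takel; last by apply: leq_trans jr; do 2 apply: ltnW.
  suff h : [/\ path G x (take i r ++ drop j.-1 r),
     last x (take i r ++ drop j.-1 r) = y &
     {subset take i r ++ drop j.-1 r <= y |: B}].
    case: h => h1 h2 h3 /(_ h1 h2 h3).
    by rewrite leqNgt shortcut_lt.
  split.
  - rewrite cat_path take_path // Ei Ej /= ab /=.
    by have := rp; rewrite -{1}(cat_take_drop j.-1 r) cat_path Ej /= => /and3P[].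
  - by rewrite last_cat -rl -{3}(cat_take_drop j.-1 r) last_cat Ej.
  - move=> z; rewrite mem_cat => /orP[/mem_take|/mem_drop]; exact: rB.
have [a [b [ac bc ab bNa aNb]]] := chG _ cyc sz.
move: ac bc; rewrite !(in_cons u).
case: (eqVneq a u) => [au _|aNu /= ar].
  case: (eqVneq b u) => [bu|_ /= br]; first by rewrite au bu (adj_irr G) in ab.
  rewrite au in ab; case: (uonly b br ab) => bE.
    by rewrite au nextu bE eqxx in bNa.
  by rewrite bE nexty au eqxx in aNb.
case: (eqVneq b u) => [bu _|bNu /= br].
  rewrite bu (adj_sym G) in ab; case: (uonly a ar ab) => aE.
    by rewrite bu nextu aE eqxx in aNb.
  by rewrite aE nexty bu eqxx in bNa.
case: (ltngtP (index a (x :: r)) (index b (x :: r))) => ij.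
- by rewrite -(noshort a b) ?eqxx in bNa.
- by rewrite -(noshort b a) ?eqxx // (adj_sym G) in aNb.
- have abE : a = b by rewrite -(nth_index x ar) ij nth_index.
  by rewrite abE (adj_irr G) in ab.
Qed.

(** Dirac's theorem, strengthened so that the induction goes through: the
    simplicial vertex can be found outside any clique Q that is not everything.
    If V is not a clique, some u in V has a non-neighbour w in V and is adjacent
    to all of Q.  Let B be the component of w among the non-neighbours of u,
    and S its boundary.  By [separator_adj] S is a clique, so the induction
    hypothesis for S + B and the clique S gives a simplicial vertex in B; all
    its neighbours lie in S + B, so it is simplicial in V. *)
Lemma simplicial_exists (V Q : {set 'I_d}) : chordal G ->
  clique adjeq Q -> Q \proper V ->
  exists v, [/\ v \in V, v \notin Q & clique adjeq [set w in V | adjeq v w]].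
Proof.
move=> chG; have [k] := ubnP #|V|; elim: k V Q => // k IH V Q; rewrite ltnS => Vk.
move=> /cliqueP Qcl /properP[/subsetP QV [z zV zQ]].
have [Vcl|] := boolP (clique adjeq V).
  exists z; split=> //; apply: cliqueS Vcl.
  by apply/subsetP => w; rewrite inE => /andP[].
rewrite /clique => /forall_inPn[u0 u0V /forall_inPn[w0 w0V nu0w0]].
(* Prefer u in Q; if every vertex of Q is adjacent to all of V, any u will do. *)
have [u [w [uV wV nuw Qu]]] : exists u w,
    [/\ u \in V, w \in V, ~~ adjeq u w & {in Q, forall q, adjeq u q}].
  have [/existsP[q /andP[qQ /existsP[w /andP[wV nqw]]]]|h] :=
      boolP [exists q in Q, exists w in V, ~~ adjeq q w].
    by exists q, w; split=> //; [apply: QV|move=> q' q'Q; apply: Qcl].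
  exists u0, w0; split=> // q qQ; rewrite adjeq_sym; apply/negPn/negP => nqu.
  case/negP: h; apply/existsP; exists q; rewrite qQ /=.
  by apply/existsP; exists u0; rewrite u0V.
pose W := [set a in V | ~~ adjeq u a].
pose eW := [rel a b | [&& a \in W, b \in W & G a b]].
have eWsym : ssrbool.symmetric eW.
  by move=> a b; rewrite /= (adj_sym G); case: (a \in W); case: (b \in W).
pose B := [set a | connect eW w a].
have wB : w \in B by rewrite inE connect0.
have wW : w \in W by rewrite inE wV.
have BW a : a \in B -> a \in W.
  rewrite inE => /connectP[p]; case/lastP: p => [|p a'] /=; first by move=> _ ->.
  by rewrite rcons_path last_rcons => /andP[_ /and3P[_ ? _]] ->.
have BV a : a \in B -> a \in V by move=> /BW; rewrite inE => /andP[].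
have uB : {in B, forall b, ~~ adjeq u b} by move=> b /BW; rewrite inE => /andP[].
pose S := [set s in V :\: B | [exists b in B, adjeq s b]].
have closB a b : b \in B -> a \in W -> adjeq a b -> a \in B.
  move=> bB aW /orP[/eqP->//|ab]; rewrite inE.
  have := bB; rewrite inE => /connect_trans; apply; apply: connect1.
  by rewrite /= BW // aW (adj_sym G).
have Su : {in S, forall s, adjeq u s}.
  move=> s; rewrite !inE => /andP[/andP[sB sV] /existsP[b /andP[bB sb]]].
  apply/negPn/negP => us; case/negP: sB; rewrite -[_ w s]inE -/B.
  by apply: (closB s b) => //; rewrite inE sV.
have uS : u \notin S.
  rewrite !inE negb_and; apply/orP; right; apply/existsP => -[b /andP[bB]].
  by rewrite (negbTE (uB b bB)).
have Scl : clique adjeq S.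
  apply/cliqueP => x y xS yS.
  have [ux uy] := (Su x xS, Su y yS).
  have {ux} ux : G u x.
    by case/orP: ux => // /eqP ux; rewrite ux xS in uS.
  have {uy} uy : G u y.
    by case/orP: uy => // /eqP uy; rewrite uy yS in uS.
  move: xS yS; rewrite inE => /andP[/setDP[xV xB] /existsP[b /andP[bB xb]]].
  rewrite inE => /andP[/setDP[yV yB] /existsP[b' /andP[b'B yb']]].
  have {xb} xb : G x b by case/orP: xb => // /eqP xb; rewrite xb bB in xB.
  have {yb'} yb' : G y b' by case/orP: yb' => // /eqP yb; rewrite yb b'B in yB.
  have : connect eW b b'.
    rewrite inE in bB; rewrite inE in b'B.
    by apply: connect_trans b'B; rewrite (sym_connect_sym eWsym).
  case/connectP => p pp pl.
  apply: (@separator_adj B u x y (rcons (b :: p) y)) => //.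
  - rewrite rcons_path /= xb -pl (adj_sym G) yb' andbT.
    by apply: sub_path pp => ? ? /and3P[].
  - by rewrite last_rcons.
  - move=> a; rewrite mem_rcons inE !(in_setU1) => /orP[->//|aP].
    apply/orP; right; rewrite inE.
    have := bB; rewrite inE => /connect_trans; apply.
    exact: (path_connect pp).
have SB : S \proper S :|: B.
  rewrite properE subsetUl /=; apply/subsetPn; exists w; first by rewrite in_setU wB orbT.
  by rewrite inE in_setD wB.
have SBV : S :|: B \subset V.
  apply/subsetP => a /setUP[|/BV//].
  by rewrite !inE => /andP[/andP[]].
have card : #|S :|: B| < k.
  apply: leq_trans Vk; apply: proper_card; apply/properP; split=> //.
  exists u => //; rewrite in_setU negb_or uS; apply/negP => /uB.
  by rewrite adjeq_refl.
have [v [/setUP vSB vS vcl]] := IH _ _ card Scl SB.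
have {vSB} vB : v \in B by case: vSB => // h; rewrite h in vS.
exists v; split; first exact: BV.
  by apply/negP => /Qu; rewrite (negbTE (uB v vB)).
apply: cliqueS vcl; apply/subsetP => a; rewrite inE => /andP[aV va].
rewrite inE va andbT in_setU; have [//|aB] := boolP (a \in B); first by rewrite orbT.
rewrite orbF inE in_setD aB aV /=; apply/existsP; exists v; by rewrite vB adjeq_sym.
Qed.

(** Connectedness of the subgraph induced by S, expressed by cuts: this form
    avoids paths constrained to stay in S. *)
Definition cut_connected (S : {set 'I_d}) :=
  forall A : {set 'I_d}, A != set0 -> A \proper S ->
    exists a b, [/\ a \in A, b \in S, b \notin A & G a b].

Lemma cut_connectedT : connected_graph G -> cut_connected setT.
Proof.
move=> [_ conn] A /set0Pn[a aA] /properP[_ [b _ bA]].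
have [|h] := boolP [exists a in A, exists b in ~: A, G a b].
  move=> /existsP[x /andP[xA /existsP[y /andP[yA xy]]]].
  by exists x, y; split => //; rewrite inE in yA.
case/negP: bA; case/connectP: (conn a b) => p; elim: p a aA => [|c p IH] a aA /=.
  by move=> _ ->.
move=> /andP[ac cp] bE; apply: (IH c) => //.
apply/negPn/negP => cA; case/negP: h; apply/existsP; exists a; rewrite aA.
by apply/existsP; exists c; rewrite inE cA.
Qed.

(** Two edges through v that cross a cut can be replaced by an edge between two
    neighbours of v, which are adjacent since v is simplicial. *)
Lemma cut_connected_rem (S : {set 'I_d}) v : v \in S ->
  clique adjeq [set w in S | adjeq v w] ->
  cut_connected S -> cut_connected (S :\ v).
Proof.
move=> vS /cliqueP vcl conn A A0 /properP[/subsetP AS [z zS zA]].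
have vA : v \notin A by apply/negP => /AS; rewrite !inE eqxx.
move: zS; rewrite !inE => /andP[zv zS].
have AS' : A \proper S.
  apply/properP; split; last by exists v.
  by apply/subsetP => a /AS; rewrite inE => /andP[].
have [a [b [aA bS bA ab]]] := conn A A0 AS'.
have [bv|bv] := eqVneq b v; last by exists a, b; split; rewrite // !inE bv.
have vA0 : v |: A != set0 by apply/set0Pn; exists v; rewrite setU11.
have vAS : v |: A \proper S.
  apply/properP; split; last by exists z; rewrite // !inE negb_or zv.
  by apply/subsetP => x /setU1P[->//|/AS]; rewrite inE => /andP[].
have [c [e [cA eS eA ce]]] := conn _ vA0 vAS.
move: eA; rewrite in_setU1 negb_or => /andP[ev eA].
case/setU1P: cA => cA; last by exists c, e; split; rewrite // !inE ev.
exists a, e; split; rewrite // ?inE ?ev //.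
have := vcl a e; rewrite !inE eS -bv adjeq_sym /adjeq ab orbT andbT.
have -> : a \in S by have := AS a aA; rewrite inE => /andP[].
rewrite bv -cA ce orbT => /(_ isT isT) /orP[/eqP ae|//].
by rewrite -ae aA in eA.
Qed.

End Chordal.

Local Open Scope ring_scope.

(** * Principal submatrices *)

Section Padding.
Variables (n : nat).
Implicit Types (A B : {set 'I_n}).

(** The principal submatrix of M on A, completed by an identity block so that
    all the submatrices considered have the same size: it is invertible exactly
    when the submatrix is, and its inverse is padded in the same way. *)
Definition pad (F : pzRingType) A (M : 'M[F]_n) : 'M[F]_n :=
  \matrix_(i, j) (if (i \in A) && (j \in A) then M i j else (i == j)%:R).

Lemma map_pad (F F' : pzRingType) (f : {rmorphism F -> F'}) A (M : 'M[F]_n) :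
  map_mx f (pad A M) = pad A (map_mx f M).
Proof. by apply/matrixP => i j; rewrite !mxE; case: ifP; rewrite // rmorph_nat. Qed.

Variable F : fieldType.
Implicit Types (M : 'M[F]_n) (x y : 'rV[F]_n).

Lemma mul_padE A M y j :
  (y *m pad A M) 0 j = if j \in A then \sum_(i in A) y 0 i * M i j else y 0 j.
Proof.
rewrite mxE; case: ifP => jA.
  rewrite [RHS]big_mkcond; apply: eq_bigr => i _; rewrite mxE jA andbT.
  by case: ifP => // iA; case: eqP iA => [->|_]; rewrite ?jA // mulr0.
rewrite (bigD1 j) //= mxE jA andbF eqxx mulr1 big1 ?addr0 // => i /negbTE ij.
by rewrite mxE jA andbF ij mulr0.
Qed.

Lemma padT M : pad setT M = M.
Proof. by apply/matrixP => i j; rewrite mxE !inE. Qed.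

Lemma eq_pad A M M' : {in A &, forall i j, M i j = M' i j} -> pad A M = pad A M'.
Proof.
move=> e; apply/matrixP => i j; rewrite !mxE.
by case: ifP => // /andP[iA jA]; apply: e.
Qed.

Lemma tr_pad A M : (pad A M)^T = pad A M^T.
Proof. by apply/matrixP => i j; rewrite !mxE andbC eq_sym. Qed.

Lemma mul_pad_subset A B M y j : B \subset A ->
  (forall i, i \notin B -> y 0 i = 0) -> j \in B ->
  (y *m pad B M) 0 j = (y *m pad A M) 0 j.
Proof.
move=> /subsetP BA y0 jB; rewrite !mul_padE jB (BA j jB).
rewrite [LHS]big_mkcond [RHS]big_mkcond; apply: eq_bigr => i _.
have [iB|iB] := boolP (i \in B); first by rewrite BA.
by case: ifP; rewrite // y0 ?mul0r.
Qed.

Lemma unitmx_rker M : (forall y, y *m M = 0 -> y = 0) -> M \in unitmx.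
Proof. by move=> h; rewrite -row_free_unit; apply: inj_row_free. Qed.

Lemma mulmx_unit0 M y : M \in unitmx -> y *m M = 0 -> y = 0.
Proof. by move=> Mu yM; rewrite -(mulmxK Mu y) yM mul0mx. Qed.

Lemma row_invmx M i y : M \in unitmx -> y *m M = delta_mx 0 i -> y = row i (invmx M).
Proof. by move=> Mu yM; rewrite rowE -yM mulmxK. Qed.

(** Here x is row v of the inverse of the submatrix on v + A, and x_v is the
    inverse of the Schur complement of the submatrix on A, if that one is
    invertible as well. *)
Section Elimination.
Variables (A : {set 'I_n}) (v : 'I_n) (M : 'M[F]_n) (x : 'rV[F]_n).
Hypotheses (vA : v \notin A) (xv : x 0 v != 0).
Hypothesis xP : x *m pad (v |: A) M = delta_mx 0 v.

Lemma mul_padU1 y j : y 0 v = 0 ->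
  (y *m pad A M) 0 j = if j == v then 0 else (y *m pad (v |: A) M) 0 j.
Proof.
move=> yv; rewrite !mul_padE in_setU1.
case: eqVneq => [->|jv] /=; first by rewrite (negbTE vA).
by case: ifP => // _; rewrite big_setU1 //= yv mul0r add0r.
Qed.

(** Both kernels are compared through multiples of x: a row vanishing at v has
    the same products with both matrices in all columns but v. *)
Lemma pad_elim_unit : (pad (v |: A) M \in unitmx) = (pad A M \in unitmx).
Proof.
apply/idP/idP => Mu; apply: unitmx_rker => y y0.
  have yv : y 0 v = 0.
    by have := mul_padE A M y v; rewrite (negbTE vA) y0 mxE.
  pose c := (y *m pad (v |: A) M) 0 v.
  have yP j : (y *m pad (v |: A) M) 0 j = c * (j == v)%:R.
    have := mul_padU1 j yv; rewrite y0 mxE.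
    by case: eqVneq => [->|_] e; rewrite ?mulr1 // mulr0 -e.
  have yE : y = c *: x.
    apply: (can_inj (mulmxK Mu)); rewrite -scalemxAl xP; apply/rowP => j.
    by rewrite yP !mxE.
  move: (yv); rewrite yE mxE => /eqP; rewrite mulf_eq0 (negbTE xv) orbF => /eqP ->.
  by rewrite scale0r.
pose c := y 0 v / x 0 v; pose z := y - c *: x.
have zv : z 0 v = 0 by rewrite !mxE divfK // subrr.
have z0 : z = 0.
  apply: (mulmx_unit0 Mu); apply/rowP => j; rewrite mul_padU1 // [RHS]mxE.
  case: eqVneq => // jv; rewrite mulmxBl y0 -scalemxAl xP !mxE (negbTE jv).
  by rewrite mulr0 subrr.
have yE : y = c *: x by apply/subr0_eq.
have /rowP/(_ v) : c *: delta_mx 0 v = 0 :> 'rV_n by rewrite -xP scalemxAl -yE.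
by rewrite !mxE !eqxx mulr1 yE => ->; rewrite scale0r.
Qed.

(** Subtracting from row i of one inverse the multiple of x that cancels its
    entry at v gives row i of the other inverse. *)
Lemma pad_elim_inv i j : M^T = M -> pad (v |: A) M \in unitmx -> i != v ->
  invmx (pad A M) i j = invmx (pad (v |: A) M) i j - x 0 i * x 0 j / x 0 v.
Proof.
move=> Msym Pu iv; have Qu : pad A M \in unitmx by rewrite -pad_elim_unit.
set k := row i (invmx (pad (v |: A) M)).
have kP : k *m pad (v |: A) M = delta_mx 0 i by rewrite -row_mul mulVmx // row1.
(* The inverse is symmetric and its row v is x. *)
have kv : k 0 v = x 0 i.
  rewrite (row_invmx Pu xP) /k !mxE -[in LHS](trmxK (invmx _)) mxE trmx_inv.
  by rewrite tr_pad Msym.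
have /rowP/(_ j) : k - (x 0 i / x 0 v) *: x = row i (invmx (pad A M)).
  apply: row_invmx => //; apply/rowP => l; rewrite mul_padU1; last first.
    by rewrite mxE kv !mxE divfK ?subrr.
  rewrite mulmxBl kP -scalemxAl xP !mxE /=.
  case: eqVneq => [->|lv]; first by rewrite eq_sym (negbTE iv).
  by rewrite mulr0 subr0.
rewrite !mxE => <-; by rewrite mulrAC.
Qed.

End Elimination.
End Padding.

(** * Completion along a decomposition into cliques *)

Section Completion.
Variables (n : nat) (F : fieldType) (H : rel 'I_n) (M0 : 'M[F]_n).
Hypotheses (Hrefl : reflexive H) (Hsym : ssrbool.symmetric H) (M0sym : M0^T = M0).
Implicit Types (A : {set 'I_n}) (M : 'M[F]_n).

Definition nbh A v := [set c in A | H v c].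

(** In Gaussian graphical models this is the pairwise Markov property of the
    covariance matrix M. *)
Definition markov A M :=
  {in A &, forall i j, ~~ H i j -> invmx (pad A M) i j = 0}.

Definition completes A M :=
  [/\ M^T = M, {in A &, forall i j, H i j -> M i j = M0 i j},
      pad A M \in unitmx & markov A M].

(** A perfect elimination order, read backwards from an initial clique, all of
    whose cliques carry an invertible submatrix of the prescribed matrix M0.
    Starting from any clique, instead of the empty set, matters for cones: the
    submatrix of a Cayley-Menger matrix on the apex alone is singular. *)
Inductive decomposable : {set 'I_n} -> Prop :=
| DecClique A : clique H A -> pad A M0 \in unitmx -> decomposable A
| DecAdd A v : decomposable A -> v \notin A -> clique H (nbh A v) ->
    pad (nbh A v) M0 \in unitmx -> pad (v |: nbh A v) M0 \in unitmx ->
    decomposable (v |: A).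

Section Step.
Variables (A : {set 'I_n}) (v : 'I_n).
Hypotheses (vA : v \notin A) (Ccl : clique H (nbh A v)).
Hypothesis C_unit : pad (nbh A v) M0 \in unitmx.
Hypothesis vC_unit : pad (v |: nbh A v) M0 \in unitmx.

Let C := nbh A v.
(** The candidate for row v of the inverse of any completion on v + A. *)
Let x : 'rV[F]_n := row v (invmx (pad (v |: C) M0)).

Let CA : v |: C \subset v |: A.
Proof. by apply: setUS; apply/subsetP => i; rewrite inE => /andP[]. Qed.

Let vC : v \notin C. Proof. by rewrite inE (negbTE vA). Qed.

Let vCcl : {in v |: C &, forall i j, H i j}.
Proof.
move=> i j /setU1P[->|iC] /setU1P[->|jC]; first exact: Hrefl.
- by move: jC; rewrite inE => /andP[].
- by move: iC; rewrite inE Hsym => /andP[].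
- by move/cliqueP: Ccl; apply.
Qed.

Let xM0 : x *m pad (v |: C) M0 = delta_mx 0 v.
Proof. by rewrite -row_mul mulVmx // row1. Qed.

Let x_supp i : i \notin v |: C -> x 0 i = 0.
Proof.
move=> iC; have := mul_padE (v |: C) M0 x i; rewrite (negbTE iC) xM0 mxE /=.
by case: eqP iC => [->|_ _ <-]; rewrite ?setU11.
Qed.

Let xv : x 0 v != 0.
Proof.
apply/negP => /eqP x0; have {}x0 : x = 0.
  apply: (mulmx_unit0 C_unit); apply/rowP => j.
  rewrite (mul_padU1 M0 vC) // xM0 !mxE.
  by case: eqP.
by move: xM0 => /rowP/(_ v); rewrite x0 mul0mx !mxE !eqxx => /eqP; rewrite eq_sym oner_eq0.
Qed.

Let x_offclique i j : i \in A -> j \in A -> ~~ H i j -> x 0 i * x 0 j = 0.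
Proof.
move=> iA jA nij; apply/eqP; rewrite mulf_eq0; apply/negPn/negP.
rewrite negb_or => /andP[xi xj]; case/negP: nij; apply: vCcl.
  by apply: contraNT xi => /x_supp ->.
by apply: contraNT xj => /x_supp ->.
Qed.

(** The correction x_i x_j / x_v between the two inverses is supported on a
    clique, so it does not affect the entries at non-edges. *)
Lemma markov_elim M : M^T = M -> x *m pad (v |: A) M = delta_mx 0 v ->
  pad (v |: A) M \in unitmx -> (markov (v |: A) M <-> markov A M).
Proof.
move=> Msym xM Mu.
have inv_eq i j : i \in A -> j \in A -> ~~ H i j ->
    invmx (pad A M) i j = invmx (pad (v |: A) M) i j.
  move=> iA jA nij; rewrite (pad_elim_inv vA xv xM) //; last by apply: contraNneq vA => <-.
  by rewrite x_offclique // mul0r subr0.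
split=> h i j.
  by move=> iA jA nij; rewrite inv_eq // h // in_setU1 (iA, jA) orbT.
have inv_v k : ~~ H v k -> invmx (pad (v |: A) M) v k = 0.
  move=> nvk; have := x_supp (i := k); rewrite (row_invmx Mu xM) mxE; apply.
  by rewrite !inE negb_or negb_and nvk orbT andbT; apply: contraNneq nvk => ->.
move=> /setU1P[->|iA]; first by move=> _; apply: inv_v.
move=> /setU1P[-> niv|jA nij]; last by rewrite -inv_eq // h.
by rewrite -[invmx _]trmxK mxE trmx_inv tr_pad Msym inv_v // Hsym.
Qed.

(** Row v of the inverse of M vanishes outside v + C, and on this clique M has
    the prescribed entries, so this row solves the system that defines x. *)
Lemma completes_row M : completes (v |: A) M -> x *m pad (v |: A) M = delta_mx 0 v.
Proof.
move=> [Msym MM0 Mu mk]; set y : 'rV[F]_n := row v (invmx (pad (v |: A) M)).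
have yM : y *m pad (v |: A) M = delta_mx 0 v by rewrite -row_mul mulVmx // row1.
have y0 i : i \notin v |: C -> y 0 i = 0.
  move=> iC; have [iA|iA] := boolP (i \in v |: A).
    rewrite mxE mk ?setU11 //; move: iC iA; rewrite !inE negb_or => /andP[iv].
    by rewrite negb_and (negbTE iv) /= => /orP[/negP|].
  have := mul_padE (v |: A) M y i; rewrite (negbTE iA) yM mxE /=.
  by case: eqP iA => [->|_ _ <-]; rewrite ?setU11.
suff -> : x = y by [].
apply/esym/row_invmx => //.
rewrite -(@eq_pad _ _ _ M); last first.
  by move=> i j iC jC; rewrite MM0 ?vCcl //; apply: (subsetP CA).
apply/rowP => j; have [jC|jC] := boolP (j \in v |: C).
  by rewrite (mul_pad_subset _ CA) // yM.
rewrite mul_padE (negbTE jC) y0 // mxE /=.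
by case: eqP jC => [->|]; rewrite ?setU11.
Qed.

Lemma completes_elim M : completes (v |: A) M -> completes A M.
Proof.
move=> Mc; have xM := completes_row Mc; case: Mc => Msym MM0 Mu mk; split=> //.
- by move=> i j iA jA; apply: MM0; rewrite in_setU1 (iA, jA) orbT.
- by rewrite -(pad_elim_unit vA xv xM).
- by apply/markov_elim.
Qed.

(** Column j of x M = e_v, for j in A, expresses M_vj through entries on A. *)
Lemma completes_eqU1 M M' : completes (v |: A) M -> completes (v |: A) M' ->
  {in A &, forall i j, M i j = M' i j} ->
  {in v |: A &, forall i j, M i j = M' i j}.
Proof.
move=> Mc M'c MM'; have [xM xM'] := (completes_row Mc, completes_row M'c).
case: Mc M'c => [Msym MM0 _ _] [M'sym M'M0 _ _].
have eqv j : j \in A -> M v j = M' v j.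
  move=> jA; have jv : j != v by apply: contraNneq vA => <-.
  have := congr1 (fun y : 'rV_n => y 0 j) (etrans xM (esym xM')).
  rewrite /= !mul_padE in_setU1 jA orbT !big_setU1 //=.
  under eq_bigr => i iA do rewrite MM' //.
  by move=> /addIr /(mulfI xv).
move=> i j /setU1P[->|iA] /setU1P[->|jA]; last exact: MM'.
- by rewrite MM0 ?M'M0 ?setU11 ?Hrefl.
- exact: eqv.
- by rewrite -[M]trmxK -[M']trmxK mxE [RHS]mxE Msym M'sym eqv.
Qed.

(** The new entries are chosen so that x M' = e_v holds. *)
Lemma completes_add M : completes A M -> exists M', completes (v |: A) M'.
Proof.
move=> [Msym MM0 Mu mk].
pose f j := if H v j then M0 v j else - (\sum_(i in A) x 0 i * M i j) / x 0 v.
pose M' : 'M_n := \matrix_(i, j)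
  if i == v then f j else if j == v then f i else M i j.
have M'A : {in A &, forall i j, M' i j = M i j}.
  move=> i j iA jA; have neqv k : k \in A -> (k == v) = false.
    by case: eqP => // ->; rewrite (negbTE vA).
  by rewrite mxE !neqv.
have M'v k : M' v k = f k by rewrite mxE eqxx.
have M'sym : M'^T = M'.
  apply/matrixP => i j; rewrite !mxE.
  have [->|_] := eqVneq i v; have [jv|_] := eqVneq j v;
    by rewrite ?jv // -[in LHS]Msym mxE.
have M'M0 : {in v |: A &, forall i j, H i j -> M' i j = M0 i j}.
  move=> i j iA jA ij; rewrite mxE.
  case: eqVneq ij iA => [->|iv] ij; first by rewrite /f ij.
  case: eqVneq jA ij => [->|jv] jA ij iA.
    by rewrite /f Hsym ij -[in LHS]M0sym mxE.
  by move: iA jA; rewrite !in_setU1 (negbTE iv) (negbTE jv) /= => iA jA; rewrite MM0.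
have xM' : x *m pad (v |: A) M' = delta_mx 0 v.
  apply/rowP => j; have [jC|jC] := boolP (j \in v |: C).
    rewrite -(mul_pad_subset _ CA) // -xM0 (@eq_pad _ _ _ _ M0) //.
    by move=> i k iC kC; apply: M'M0; rewrite ?vCcl // (subsetP CA).
  have jv : j != v by apply: contraNneq jC => ->; rewrite setU11.
  rewrite mul_padE in_setU1 (negbTE jv) [RHS]mxE /= (negbTE jv).
  case: ifP => jA; last by rewrite x_supp.
  have nvj : ~~ H v j by move: jC; rewrite !inE (negbTE jv) jA.
  rewrite big_setU1 //= M'v /f (negbTE nvj) mulrC divfK //.
  by under [X in _ + X]eq_bigr => i iA do rewrite M'A //; rewrite addNr.
have padA : pad A M' = pad A M by apply: eq_pad.
have M'u : pad (v |: A) M' \in unitmx by rewrite (pad_elim_unit vA xv xM') padA.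
exists M'; split=> //; apply/markov_elim => //.
by rewrite /markov padA.
Qed.

End Step.

Theorem completes_exists A : decomposable A -> exists M, completes A M.
Proof.
elim=> [{}A Acl Au|{}A v _ [M Mc] vA Ccl Cu vCu].
  by exists M0; split=> // i j iA jA /negP[]; move/cliqueP: Acl; apply.
exact: completes_add Mc.
Qed.

Theorem completes_unique A M M' : decomposable A ->
  completes A M -> completes A M' -> {in A &, forall i j, M i j = M' i j}.
Proof.
move=> Adec; elim: Adec M M' => [{}A Acl Au|{}A v _ IH vA Ccl Cu vCu] M M' Mc M'c.
  move: Mc M'c => [_ MM0 _ _] [_ M'M0 _ _] i j iA jA.
  have ij : H i j by move/cliqueP: Acl; apply.
  by rewrite MM0 ?M'M0.
apply: (completes_eqU1 vA Ccl Cu vCu Mc M'c).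
by apply: IH; apply: completes_elim; eauto.
Qed.

End Completion.

(** * The cone over a graph *)

Section Cone.
Variables (d : nat) (G : sgraph d).
Implicit Types S : {set 'I_d}.

Definition apex : 'I_(d + 1) := rshift d ord0.

Definition cone S : {set 'I_(d + 1)} := apex |: [set lshift 1 i | i in S].

Definition cone_adj : rel 'I_(d + 1) := fun k l =>
  match split k, split l with inl i, inl j => adjeq G i j | _, _ => true end.

Variant cone_spec : 'I_(d + 1) -> Prop :=
  | ConeBase i : cone_spec (lshift 1 i)
  | ConeApex : cone_spec apex.

Lemma coneP k : cone_spec k.
Proof.
by case: (split_ordP k) => [i ->|j ->]; [|rewrite [j]ord1]; constructor.
Qed.

Lemma apex_lshift i : (lshift 1 i == apex) = false.
Proof. exact: eq_lrshift. Qed.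

Lemma lshift_in_cone i S : (lshift 1 i \in cone S) = (i \in S).
Proof. by rewrite in_setU1 apex_lshift mem_imset //; apply: lshift_inj. Qed.

Lemma apex_in_cone S : apex \in cone S.
Proof. exact: setU11. Qed.

Lemma cone_adj_lshift i j : cone_adj (lshift 1 i) (lshift 1 j) = adjeq G i j.
Proof. by rewrite /cone_adj !(unsplitK (inl _)). Qed.

Lemma cone_adj_apexl k : cone_adj apex k.
Proof. by rewrite /cone_adj (unsplitK (inr _)). Qed.

Lemma cone_adj_sym : ssrbool.symmetric cone_adj.
Proof.
by move=> k l; rewrite /cone_adj; case: (split k); case: (split l) => // *; apply: adjeq_sym.
Qed.

Lemma cone_adj_apexr k : cone_adj k apex.
Proof. by rewrite cone_adj_sym cone_adj_apexl. Qed.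

Lemma cone_adj_refl : reflexive cone_adj.
Proof. by move=> k; rewrite /cone_adj; case: (split k) => // i; apply: adjeq_refl. Qed.

Lemma coneT : cone setT = setT.
Proof. by apply/setP => k; case: (coneP k) => [i|]; rewrite ?apex_in_cone ?lshift_in_cone !inE. Qed.

Lemma clique_cone S : clique (adjeq G) S -> clique cone_adj (cone S).
Proof.
move=> /cliqueP Scl; apply/cliqueP => k l; case: (coneP k) => [i|]; last first.
  by rewrite cone_adj_apexl.
case: (coneP l) => [j|]; last by rewrite cone_adj_apexr.
by rewrite !lshift_in_cone cone_adj_lshift; apply: Scl.
Qed.

(** Dirac's theorem and connectedness produce the decomposition: each vertex is
    added to a connected set, so its earlier neighbours form a nonempty clique
    and both submatrices involved are those of cones over nonempty cliques. *)
Lemma cone_decomposable (F : fieldType) (M0 : 'M[F]_(d + 1)) S :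
  chordal G -> S != set0 -> cut_connected G S ->
  (forall C, C != set0 -> clique (adjeq G) C -> pad (cone C) M0 \in unitmx) ->
  decomposable cone_adj M0 (cone S).
Proof.
move=> chG + + good; have [k] := ubnP #|S|; elim: k S => // k IH S; rewrite ltnS.
move=> Sk S0 conn.
have [||v [vS _ vcl]] := @simplicial_exists _ G S set0 chG.
- by apply/cliqueP => x y; rewrite inE.
- by rewrite properE sub0set /= subset0.
pose S' := S :\ v; pose C := [set w in S' | adjeq G v w].
have [SE|SNv] := eqVneq S [set v].
  have Scl : clique (adjeq G) S.
    by apply/cliqueP => x y; rewrite SE !inE => /eqP-> /eqP->; apply: adjeq_refl.
  by apply: DecClique; [apply: clique_cone|apply: good].
have vprop : [set v] \proper S by rewrite properEneq eq_sym SNv sub1set.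
have v0 : [set v] != set0 by apply/set0Pn; exists v; rewrite inE.
have C0 : C != set0.
  have [a [b [/set1P-> bS bv vb]]] := conn _ v0 vprop.
  by apply/set0Pn; exists b; move: bv; rewrite !inE bS /adjeq vb orbT => ->.
have S'0 : S' != set0.
  by case/set0Pn: C0 => b; rewrite inE => /andP[bS _]; apply/set0Pn; exists b.
have coneE A : cone (v |: A) = lshift 1 v |: cone A.
  by rewrite /cone imsetU1 setUCA.
have nbhE : nbh cone_adj (cone S') (lshift 1 v) = cone C.
  apply/setP => l; rewrite inE; case: (coneP l) => [j|].
    by rewrite !lshift_in_cone cone_adj_lshift [RHS]inE.
  by rewrite !apex_in_cone cone_adj_apexr.
have vC : v |: C \subset [set w in S | adjeq G v w].
  apply/subsetP => w /setU1P[->|]; rewrite ?inE ?vS ?adjeq_refl //.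
  by move=> /andP[/andP[_ ->] ->].
rewrite -(setD1K vS) coneE; apply: DecAdd; rewrite ?nbhE.
- apply: IH => //; last exact: cut_connected_rem.
  by apply: leq_trans Sk; rewrite [leqRHS](cardsD1 v) vS.
- by rewrite lshift_in_cone !inE eqxx.
- by apply/clique_cone/(cliqueS _ vcl)/(subset_trans _ vC)/subsetUr.
- by apply: good => //; apply/(cliqueS _ vcl)/(subset_trans _ vC)/subsetUr.
- rewrite -coneE; apply: good; last exact: cliqueS vC vcl.
  by apply/set0Pn; exists v; rewrite setU11.
Qed.

Lemma sum_cone (V : nmodType) (f : 'I_(d + 1) -> V) S :
  \sum_(k in cone S) f k = f apex + \sum_(i in S) f (lshift 1 i).
Proof.
rewrite big_setU1 /=; last by apply/negP => /imsetP[i _ /eqP]; rewrite eq_sym apex_lshift.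
by rewrite big_imset //= => i j _ _ /lshift_inj.
Qed.

End Cone.

(** * Prescribed distances and Cayley-Menger matrices *)

Section EdgeMatrix.
Variables (d : nat) (G : sgraph d).

(** Written as a sum so that it makes sense over any additive monoid and
    commutes with morphisms: at most one edge contributes to each entry. *)
Definition edge_mx (V : nmodType) (g : edge G -> V) : 'M[V]_d :=
  \matrix_(i, j) \sum_(e : edge G | (val e == (i, j)) || (val e == (j, i))) g e.

Lemma edge_mxE (V : nmodType) (g : edge G -> V) (e : edge G) :
  edge_mx g (val e).1 (val e).2 = g e.
Proof.
rewrite mxE (big_pred1 e) // => e' /=; rewrite -surjective_pairing.
rewrite -[e' == e]/(val e' == val e); case: eqP => //= _.
case: e e' => [[i j] /= ij] [[k l] /= kl]; apply/eqP => -[ki lj].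
case/andP: ij => /= ij _; case/andP: kl => /=.
by rewrite ki lj ltnNge (ltnW ij).
Qed.

Lemma edge_mx_sym (V : nmodType) (g : edge G -> V) : (edge_mx g)^T = edge_mx g.
Proof. by apply/matrixP => i j; rewrite !mxE; apply: eq_bigl => e; rewrite orbC. Qed.

Lemma edge_mx_diag (V : nmodType) (g : edge G -> V) i : edge_mx g i i = 0.
Proof.
rewrite mxE big1 // => e; rewrite orbb => /eqP ei.
by case/andP: (valP e); rewrite ei ltnn.
Qed.

Lemma adj_edge i j : G i j -> exists e : edge G, val e = (i, j) \/ val e = (j, i).
Proof.
have edgeI (k l : 'I_d) : (k < l)%N -> G k l -> exists e : edge G, val e = (k, l).
  move=> lt kl; have h : (k < l)%N && G k l by rewrite lt.
  by exists (exist (fun p : 'I_d * 'I_d => is_true ((p.1 < p.2)%N && G p.1 p.2)) (k, l) h).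
move=> ij; case: (ltngtP i j) => [lt|lt|/val_inj eq].
- by have [e] := edgeI _ _ lt ij; exists e; left.
- by rewrite adj_sym in ij; have [e] := edgeI _ _ lt ij; exists e; right.
- by rewrite eq adj_irr in ij.
Qed.

Lemma edge_mx_ext (V : nmodType) (g : edge G -> V) (Gam : 'M[V]_d) :
  Gam^T = Gam -> (forall i, Gam i i = 0) ->
  (forall e : edge G, Gam (val e).1 (val e).2 = g e) ->
  forall i j, adjeq G i j -> Gam i j = edge_mx g i j.
Proof.
move=> sym diag ge i j /orP[/eqP->|/adj_edge[e]]; first by rewrite diag edge_mx_diag.
case=> eE; have := ge e; rewrite -(edge_mxE g e) eE //= => h.
by rewrite -[edge_mx g]edge_mx_sym -[Gam]sym mxE [RHS]mxE.
Qed.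

Lemma map_edge_mx (V V' : nmodType) (f : {additive V -> V'}) (g : edge G -> V) :
  map_mx f (edge_mx g) = edge_mx (fun e => f (g e)).
Proof. by apply/matrixP => i j; rewrite !mxE raddf_sum. Qed.

End EdgeMatrix.

Section Bordered.
Variable d : nat.

(** CM over any ring, with h in place of 1/2; this covers matrices of
    polynomials in the edge values. *)
Definition bordered (T : pzRingType) (h : T) (Gam : 'M[T]_d) : 'M[T]_(d + 1) :=
  block_mx (- (h *: Gam)) (const_mx 1) (const_mx 1) 0.

Lemma map_bordered (T T' : pzRingType) (f : {rmorphism T -> T'}) h (Gam : 'M[T]_d) :
  map_mx f (bordered h Gam) = bordered (f h) (map_mx f Gam).
Proof.
by rewrite map_block_mx map_mxN map_mxZ !map_const_mx rmorph1 raddf0.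
Qed.

Variable F : fieldType.
Implicit Type Gam : 'M[F]_d.

Lemma CM_lshift Gam i j :
  CM Gam (lshift 1 i) (lshift 1 j) = - (2%:R^-1 * Gam i j).
Proof. by rewrite block_mxEul !mxE. Qed.

Lemma CM_lapex Gam i : CM Gam (lshift 1 i) (apex d) = 1.
Proof. by rewrite block_mxEur mxE. Qed.

Lemma CM_apexl Gam i : CM Gam (apex d) (lshift 1 i) = 1.
Proof. by rewrite block_mxEdl mxE. Qed.

Lemma CM_apex Gam : CM Gam (apex d) (apex d) = 0.
Proof. by rewrite block_mxEdr mxE. Qed.

Lemma tr_CM Gam : (CM Gam)^T = CM Gam^T.
Proof. by rewrite tr_block_mx linearN linearZ !trmx_const raddf0. Qed.

End Bordered.

(** For a kernel vector y, the apex column says that the entries of y on S have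
    sum 0, and then column i says that y_i = - 2 y_apex for each i in S.
    Summing over S gives y_apex = 0, because S is nonempty. *)
Lemma simplex_unit (F : numFieldType) (d : nat) (S : {set 'I_d}) (Gam : 'M[F]_d) :
  S != set0 -> {in S &, forall i j, Gam i j = (i != j)%:R} ->
  pad (cone S) (CM Gam) \in unitmx.
Proof.
move=> S0 GamE; apply: unitmx_rker => y y0.
pose s := \sum_(i in S) y 0 (lshift 1 i).
have yE k : (if k \in cone S then
    \sum_(l in cone S) y 0 l * CM Gam l k else y 0 k) = 0.
  by rewrite -mul_padE y0 mxE.
have s0 : s = 0.
  have := yE (apex d); rewrite apex_in_cone sum_cone CM_apex mulr0 add0r => <-.
  by apply: eq_bigr => i _; rewrite CM_lapex mulr1.
have yS i : i \in S -> y 0 (lshift 1 i) = - (2%:R * y 0 (apex d)).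
  move=> iS; have := yE (lshift 1 i); rewrite lshift_in_cone iS sum_cone CM_apexl mulr1.
  have -> : \sum_(j in S) y 0 (lshift 1 j) * CM Gam (lshift 1 j) (lshift 1 i) =
      2%:R^-1 * y 0 (lshift 1 i).
    transitivity (\sum_(j in S) (- 2%:R^-1 * y 0 (lshift 1 j) +
        (if j == i then 2%:R^-1 * y 0 (lshift 1 i) else 0))).
      apply: eq_bigr => j jS; rewrite CM_lshift GamE // mulrC.
      have [->|_] := eqVneq j i; first by rewrite mulr0 oppr0 mul0r mulNr addNr.
      by rewrite mulr1 addr0.
    rewrite big_split /= -mulr_sumr -/s s0 mulr0 add0r (bigD1 i) //= eqxx.
    by rewrite big1 ?addr0 // => j /andP[_ /negbTE->].
  move/eqP; rewrite addrC addr_eq0 => /eqP h.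
  by rewrite -[LHS](mulVKf (_ : 2%:R != 0)) ?pnatr_eq0 // h mulrN.
have yapex : y 0 (apex d) = 0.
  have : s = - (2%:R * y 0 (apex d)) *+ #|S|.
    by rewrite -sumr_const; apply: eq_bigr => i /yS.
  rewrite s0 => /esym/eqP; rewrite mulrn_eq0 cards_eq0 (negbTE S0) /=.
  by rewrite oppr_eq0 mulf_eq0 pnatr_eq0 /= => /eqP.
apply/rowP => k; rewrite mxE; case: (coneP k) => [i|] //.
have [iS|iS] := boolP (i \in S); first by rewrite yS // yapex mulr0 oppr0.
by have := yE (lshift 1 i); rewrite lshift_in_cone (negbTE iS).
Qed.

(** * The generic number of completions *)

Section Generic.
Variables (R : realType) (d : nat) (G : sgraph d).
Implicit Types (S : {set 'I_d}) (g : edge G -> R).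

(** Prescribed are the entries on the diagonal and on the edges of the cone; the
    value 0 elsewhere is a placeholder. *)
Definition prescribed_CM g : 'M[R[i]]_(d + 1) := CM (edge_mx (fun e => (g e)%:C%C)).

(** The Cayley-Menger determinant of S, as a polynomial in the edge values. *)
Definition clique_det S : {mpoly R[#|{: edge G}|]} :=
  \det (pad (cone S)
    (bordered (2%:R^-1)%:MP (edge_mx (fun e : edge G => 'X_(enum_rank e))))).

Lemma clique_detE S g :
  edge_eval (clique_det S) g = \det (pad (cone S) (CM (edge_mx g))).
Proof.
rewrite /edge_eval -det_map_mx map_pad map_bordered [X in bordered X]mevalC map_edge_mx.
congr (\det (pad _ (bordered _ _))); apply/matrixP => i j; rewrite !mxE.
by apply: eq_bigr => e _; rewrite [LHS]mevalXU enum_rankK.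
Qed.

Lemma clique_det_data S g :
  (edge_eval (clique_det S) g)%:C%C = \det (pad (cone S) (prescribed_CM g)).
Proof.
rewrite clique_detE -det_map_mx map_pad map_bordered map_edge_mx.
by rewrite fmorphV rmorph_nat.
Qed.

(** The reduction to the completion problem on the cone. *)
Lemma completionP g (Gam : 'M[R[i]]_d) :
  completion g Gam <-> completes (cone_adj G) (prescribed_CM g) setT (CM Gam).
Proof.
rewrite /completes /markov padT; split.
  move=> [sym diag Mu ge zero]; split; [by rewrite tr_CM sym| |exact: Mu|].
    move=> k l _ _; case: (coneP k) => [i|]; case: (coneP l) => [j|]; rewrite /prescribed_CM.
    - rewrite cone_adj_lshift => ij; rewrite [LHS]CM_lshift [RHS]CM_lshift.
      by congr (- (_ * _)); apply: edge_mx_ext.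
    - by rewrite [LHS]CM_lapex [RHS]CM_lapex.
    - by rewrite [LHS]CM_apexl [RHS]CM_apexl.
    - by rewrite [LHS]CM_apex [RHS]CM_apex.
  move=> k l _ _; case: (coneP k) => [i|]; last by rewrite cone_adj_apexl.
  case: (coneP l) => [j|]; last by rewrite cone_adj_apexr.
  rewrite cone_adj_lshift negb_or => /andP[ij nG].
  by have := zero i j ij nG; rewrite /theta !mxE.
move=> [sym ext Mu mk].
have GamE i j : adjeq G i j -> Gam i j = edge_mx (fun e => (g e)%:C%C) i j.
  move=> ij; have := ext (lshift 1 i) (lshift 1 j); rewrite !inE cone_adj_lshift.
  move=> /(_ isT isT ij); rewrite /prescribed_CM [LHS]CM_lshift [RHS]CM_lshift => /oppr_inj /mulfI; apply.
  by rewrite invr_eq0 pnatr_eq0.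
split=> //.
- apply/matrixP => i j; rewrite mxE.
  have /matrixP/(_ (lshift 1 i) (lshift 1 j)) := sym.
  rewrite tr_CM [LHS]CM_lshift [RHS]CM_lshift mxE => /oppr_inj /mulfI; apply.
  by rewrite invr_eq0 pnatr_eq0.
- by move=> i; rewrite GamE ?adjeq_refl // edge_mx_diag.
- move=> e; rewrite GamE ?edge_mxE // /adjeq.
  by case/andP: (valP e) => _ ->; rewrite orbT.
- move=> i j ij nG; rewrite /theta !mxE; apply: mk; rewrite ?inE //.
  by rewrite cone_adj_lshift negb_or ij.
Qed.

(** Since the apex is adjacent to all vertices, the border is prescribed. *)
Lemma completes_CM g M : completes (cone_adj G) (prescribed_CM g) setT M ->
  exists Gam, M = CM Gam.
Proof.
move=> [_ ext _ _]; exists (- (2%:R *: ulsubmx M)).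
have MD k l : cone_adj G k l -> M k l = prescribed_CM g k l by move=> kl; apply: ext; rewrite ?inE.
apply/matrixP => k l; case: (coneP k) => [i|]; case: (coneP l) => [j|].
- by rewrite CM_lshift !mxE mulrN opprK mulKf // pnatr_eq0.
- by rewrite (MD _ _ (cone_adj_apexr G _)) /prescribed_CM [LHS]CM_lapex [RHS]CM_lapex.
- by rewrite (MD _ _ (cone_adj_apexl G _)) /prescribed_CM [LHS]CM_apexl [RHS]CM_apexl.
- by rewrite (MD _ _ (cone_adj_apexl G _)) /prescribed_CM [LHS]CM_apex [RHS]CM_apex.
Qed.

Lemma CM_inj : injective (@CM R[i] d).
Proof.
move=> Gam Gam' /matrixP e; apply/matrixP => i j.
have := e (lshift 1 i) (lshift 1 j); rewrite [LHS]CM_lshift [RHS]CM_lshift.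
move=> /oppr_inj /mulfI; apply; by rewrite invr_eq0 pnatr_eq0.
Qed.

Lemma unique_completion g : chordal G -> connected_graph G ->
  (forall S, S != set0 -> clique (adjeq G) S -> edge_eval (clique_det S) g != 0) ->
  num_completions g 1.
Proof.
move=> chG conn good.
have T0 : [set: 'I_d] != set0.
  by case: conn => d0 _; apply/set0Pn; exists (Ordinal d0); rewrite inE.
have dec : decomposable (cone_adj G) (prescribed_CM g) setT.
  rewrite -coneT; apply: cone_decomposable => //; first exact: cut_connectedT.
  move=> C C0 Ccl; rewrite unitmxE unitfE -clique_det_data.
  by rewrite fmorph_eq0 good.
have symD : (prescribed_CM g)^T = prescribed_CM g by rewrite tr_CM edge_mx_sym.
have [M Mc] := completes_exists (@cone_adj_refl _ G) (@cone_adj_sym _ G) symD dec.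
have [Gam ME] := completes_CM Mc; rewrite ME in Mc.
exists [:: Gam]; split=> // Gam'; rewrite inE; split=> [/eqP->|].
  by apply/completionP.
move=> /completionP Mc'; apply/eqP/CM_inj/matrixP => k l.
by apply: (completes_unique (@cone_adj_refl _ G) (@cone_adj_sym _ G) dec Mc' Mc); rewrite inE.
Qed.

End Generic.

Unset Implicit Arguments.

Theorem corollary4p5 (R : realType) (d : nat) (G : sgraph d)
  (hconn : connected_graph G) (hchordal : chordal G) :
  eMLD R G 1.
Proof.
pose P := \prod_(S : {set 'I_d} | (S != set0) && clique (adjeq G) S)
  clique_det R G S.
have evalP g : edge_eval P g = \prod_(S : {set 'I_d} |
    (S != set0) && clique (adjeq G) S) edge_eval (clique_det R G S) g.
  by rewrite /edge_eval rmorph_prod.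
exists (fun g => edge_eval P g = 0); split.
- exists (fun p => p = P) => g; split=> [Pg p -> //|]; exact.
- exists (fun=> 1); apply/eqP; rewrite evalP; apply/prodf_neq0 => S /andP[S0 Scl].
  rewrite clique_detE -unitfE -unitmxE; apply: simplex_unit => // i j iS jS.
  have [->|ij] := eqVneq i j; first by rewrite edge_mx_diag.
  have /cliqueP/(_ i j iS jS) := Scl; rewrite /adjeq (negbTE ij) => /adj_edge[e [] eE].
    by have := edge_mxE (fun=> 1 : R) e; rewrite eE.
  by have := edge_mxE (fun=> 1 : R) e; rewrite eE -[in X in _ -> X]edge_mx_sym [in X in _ -> X]mxE.
- move=> g /eqP; rewrite evalP => /prodf_neq0 good; apply: unique_completion => // S S0 Scl.
  by apply: good; rewrite S0.
Qed.
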